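(* Let $q$ be a prime power, $M=[m_{i\gamma}\mid 1\le i\le n,\gamma\in\mathbb{F}]$ a matrix of nonnegative integers, and $l\ge 0$ an integer. Let $g_{s,t}\in R[z]$ ($0\le s\le l$, $0\le t\le q-1$) be produced by performing the following steps successively for $s=0,1,\dots,l$, where the $m_{i\gamma}$ are updated along the way. (B1) Let $n_i=\max_{\gamma\in\mathbb{F}}m_{i\gamma}$ for $1\le i\le n$, let $L=\{1\le i\le n\mid n_i\ge1\}$, and for each $i\in L$ choose $\gamma_i\in\mathbb{F}$ with $n_i=m_{i\gamma_i}$. Choose a set of generators $\{\eta_0,\dots,\eta_{q-1}\}$ of $\{f\in R\mid v_{P_i}(f)\ge n_i\text{ for all }1\le i\le n\}$ as a module over $\mathbb{F}[x]$ (taking $\eta_t=y^t$ when $L$ is empty), and set $g_{s,t}=\eta_t\prod_{0\le r<s}(z-h^{(r)})$ for $0\le t\le q-1$. (B2) Set $h^{(s)}=\sum_{i\in L}\gamma_ih_i$, and for each $i\in L$ replace $m_{i\gamma_i}$ by $m_{i\gamma_i}-1$, leaving all other $m_{i\gamma}$ unchanged. Then $\{g_{s,t}\mid 0\le s\le l,\ 0\le t\le q-1\}$ generates $I_{M,l}$ as a module over $\mathbb{F}[x]$, where $I_{M,l}$ is defined from the initial input matrix $M$.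
   Context: $\mathbb{F}$ is a finite field with $q^2$ elements. The Hermitian curve $H$ is the affine plane curve $Y^q+Y-X^{q+1}=0$ over $\mathbb{F}$, with coordinate ring $R=\mathbb{F}[X,Y]/\langle Y^q+Y-X^{q+1}\rangle=\mathbb{F}[x,y]$, which is a free $\mathbb{F}[x]$-module with basis $1,y,\dots,y^{q-1}$. $H$ has $n=q^3$ rational points $P_i=(\alpha_i,\beta_i)$, $1\le i\le n$. For a rational point $P$ of $H$, $\mathfrak{m}_P=\{f\in R\mid f(P)=0\}$, and for nonzero $f\in R$, $v_P(f)$ is the largest integer $r$ with $f\in\mathfrak{m}_P^r$ ($v_P(0)=\infty$). For a rational point $S=(P_i,\gamma)$, $\gamma\in\mathbb{F}$, of $H\times\mathbb{A}^1_{\mathbb{F}}$, let $\mathfrak{m}_S=\{f\in R[z]\mid f(S)=0\}$; $\mathrm{mult}_S(f)$ is the largest integer $r$ with $f\in\mathfrak{m}_S^r$ ($\mathrm{mult}_S(0)=\infty$). $I_M=\{f\in R[z]\mid \mathrm{mult}_{(P_i,\gamma)}(f)\ge m_{i\gamma}\text{ for all }1\le i\le n,\gamma\in\mathbb{F}\}$, and $I_{M,l}=\{f\in I_M\mid f\text{ has degree at most }l\text{ in }z\}$. For $1\le i\le n$, $h_i\in R$ is $$h_i=-\frac{(x^{q^2}-x)(y^q+y-\beta_i^q-\beta_i)}{(x-\alpha_i)(y-\beta_i)},$$ meaning minus the product of the polynomial quotients $(X^{q^2}-X)/(X-\alpha_i)$ and $(Y^q+Y-\beta_i^q-\beta_i)/(Y-\beta_i)$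 evaluated at $X=x$, $Y=y$. The empty product is $1$ and the empty sum is $0$. *)

(* Defs.v *)
From HB Require Import structures.
From mathcomp Require Import all_boot all_order all_algebra.

Set Implicit Arguments.
Unset Strict Implicit.
Unset Printing Implicit Defensive.

Import GRing.Theory.
Local Open Scope ring_scope.

(* [f] lies in the [r]-th power of the ideal [I]; for [r = 0] the products are
   empty and every element of [A] qualifies. *)
Definition idealpow (A : comNzRingType) (I : A -> Prop) (r : nat) (f : A)
  : Prop :=
  exists (k : nat) (c : 'I_k -> A) (a : 'I_k -> 'I_r -> A),
    (forall i j, I (a i j)) /\ f = \sum_(i < k) c i * \prod_(j < r) a i j.

Definition order_is (A : comNzRingType) (I : A -> Prop) (f : A) (r : nat)
  : Prop :=
  idealpow I r f /\ forall r', idealpow I r' f -> (r' <= r)%N.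

(* The largest [r] with [f] in [I ^ r] exists and is at least [n], or [f = 0],
   whose order is infinite by convention. *)
Definition order_ge (A : comNzRingType) (I : A -> Prop) (f : A) (n : nat)
  : Prop :=
  f = 0 \/ exists r, order_is I f r /\ (n <= r)%N.

Section Hermitian.
Variables (F : finFieldType) (q : nat).

(* The outer variable of [{poly {poly F}}] is [Y], the inner one is [X]. *)
Definition hermite_poly : {poly {poly F}} := 'X^q + 'X - ('X^(q.+1))%:P.

(* [{poly %/ p}] is the quotient by [mk_monic p], which is [p] only when [p]
   is monic and not constant. *)
Lemma mk_monic_hermite : (1 < q)%N -> mk_monic hermite_poly = hermite_poly.
Proof.
move=> q_gt1.
have size_h : size hermite_poly = q.+1.
  rewrite /hermite_poly -addrA size_polyDl size_polyXn // ltnS.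
  rewrite (leq_trans (size_polyD _ _)) // size_polyX size_polyN.
  by rewrite geq_max q_gt1 (leq_trans (size_polyC_leq1 _)) // ltnW.
have mon_h : hermite_poly \is monic.
  rewrite monicE lead_coefE size_h /= /hermite_poly.
  rewrite coefB coefD coefXn coefX coefC eqxx gtn_eqF // gtn_eqF ?addr0 ?subr0 //.
  exact: ltnW.
by rewrite /mk_monic size_h mon_h ltnS ltnW.
Qed.

Definition hermite_ring : comAlgType {poly F} := {poly %/ hermite_poly}.
Local Notation R := hermite_ring.

Definition point : finType :=
  {P : F * F | P.2 ^+ q + P.2 == P.1 ^+ q.+1}.
Definition px (P : point) : F := (val P).1.
Definition py (P : point) : F := (val P).2.

(* Value at [P] of the representative of [f] of degree [< q] in [Y]. *)
Definition evalR (P : point) (f : R) : F :=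
  ((f : {poly %/ hermite_poly}) : {poly {poly F}}).[(py P)%:P].[px P].

Definition evalRz (P : point) (c : F) (f : {poly R}) : F :=
  (map_poly (evalR P) f).[c].

Definition vR_ge (P : point) (f : R) (n : nat) : Prop :=
  order_ge (fun u : R => evalR P u = 0) f n.

Definition mult_ge (P : point) (c : F) (f : {poly R}) (n : nat) : Prop :=
  order_ge (fun u : {poly R} => evalRz P c u = 0) f n.

Definition multmatrix : Type := point -> F -> nat.

Definition IM (m : multmatrix) (f : {poly R}) : Prop :=
  forall P c, mult_ge P c f (m P c).

(* degree at most [l] in [z]; [size 0 = 0] *)
Definition IMl (m : multmatrix) (l : nat) (f : {poly R}) : Prop :=
  IM m f /\ (size f <= l.+1)%N.

(* The [F[x]]-module generated by a finite family, in [R] and in [R[z]];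
   [p%:A] is the image of [p : F[x]] in [R]. *)
Definition spanR (I : finType) (e : I -> R) (f : R) : Prop :=
  exists c : I -> {poly F}, f = \sum_i c i *: e i.

Definition spanRz (I : finType) (e : I -> {poly R}) (f : {poly R}) : Prop :=
  exists c : I -> {poly F}, f = \sum_i (c i)%:A *: e i.

Definition ybar : R := in_qpoly hermite_poly 'X.

Definition hfun (P : point) : R :=
  let quotX : {poly F} := ('X^(q ^ 2) - 'X) %/ ('X - (px P)%:P) in
  let quotY : {poly F} :=
    ('X^q + 'X - (py P ^+ q)%:P - (py P)%:P) %/ ('X - (py P)%:P) in
  - in_qpoly hermite_poly (quotX%:P * map_poly polyC quotY).

Definition maxmult (m : multmatrix) (P : point) : nat := (\max_(c : F) m P c)%N.

Definition Lset (m : multmatrix) : {set point} :=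
  [set P | (1 <= maxmult m P)%N].

Definition hstep (m : multmatrix) (gam : point -> F) : R :=
  \sum_(P in Lset m) (gam P)%:P *: hfun P.

Definition lower (m : multmatrix) (gam : point -> F) : multmatrix :=
  fun P c => if (P \in Lset m) && (c == gam P) then (m P c).-1 else m P c.

(* The matrix at the beginning of round [s], starting from [M], when [gam r]
   is the choice of the [gamma_i] made in round [r]; the values of [gam r]
   off the set [L] of that round are irrelevant. *)
Fixpoint mat (M : multmatrix) (gam : nat -> point -> F) (s : nat)
  : multmatrix :=
  if s is s'.+1 then lower (mat M gam s') (gam s') else M.

(* The constraints on the choices made in a round with current matrix [m]. *)
Definition valid_choice (m : multmatrix) (gam : point -> F) (eta : 'I_q -> R)
  : Prop :=
  [/\ forall P, P \in Lset m -> m P (gam P) = maxmult m P,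
      forall f, spanR eta f <-> forall P, vR_ge P f (maxmult m P)
    & Lset m = set0 -> forall t, eta t = ybar ^+ t].

Definition gpoly (M : multmatrix) (gam : nat -> point -> F)
  (eta : nat -> 'I_q -> R) (s : nat) (t : 'I_q) : {poly R} :=
  (eta s t)%:P * \prod_(r < s) ('X - (hstep (mat M gam r) (gam r))%:P).

End Hermitian.

(* Main.v *)
From HB Require Import structures.
Require Import Defs.
From Stdlib Require Import Classical.
From mathcomp Require Import all_boot all_order all_algebra all_field.
From mathcomp Require Import zify ring.

(* Substituting z = h, where h = h^(0) takes the value gamma_i at P_i, sends
   the maximal ideal of (P_i, gamma_i) into that of P_i; hence f(h) has order
   at least n_i at P_i and lies in the span of the eta_t of the first round.
   The quotient of f - f(h) by z - h has degree one less in z, and its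
   multiplicity bounds are those of the updated matrix: z - h is a unit at
   (P_i, gamma) for gamma <> gamma_i, while at (P_i, gamma_i) dividing by it
   lowers the order by exactly one, as one sees on Taylor coefficients at h.
   Iterating gives the theorem.

   That orders of nonzero functions are finite rests on the irreducibility of
   the curve.  With the weights deg x = q and deg y = q + 1, an element of R
   has a monomial as leading form, whereas the equation of the curve has
   leading form Y^q - X^(q+1), which vanishes at (1, 1).  So a nonzero a in R
   divides a nonzero N in F[x]; and u = (y^q + y - beta^q - beta) / (y - beta),
   with u(P) = 1, sends m_P into (x - alpha) R, which bounds the order of N. *)

Set Implicit Arguments.
Unset Strict Implicit.
Unset Printing Implicit Defensive.

Import GRing.Theory.
Local Open Scope ring_scope.

(** * Powers of an ideal and the order of an element *)

Section IdealPowers.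
Variables (A : comNzRingType) (I : A -> Prop).

Lemma idealpow0 n : idealpow I n 0.
Proof. by exists 0%N, (fun=> 0), (fun _ _ => 0); split=> [[]|]; rewrite ?big_ord0. Qed.

Lemma idealpow_prod n c (a : 'I_n -> A) :
  (forall j, I (a j)) -> idealpow I n (c * \prod_(j < n) a j).
Proof.
by move=> Ia; exists 1%N, (fun=> c), (fun=> a); split=> //; rewrite big_ord1.
Qed.

Lemma idealpow_exp0 f : idealpow I 0 f.
Proof.
by have := @idealpow_prod 0 f (fun=> 0); rewrite big_ord0 mulr1; apply; case.
Qed.

Lemma idealpowD n f g :
  idealpow I n f -> idealpow I n g -> idealpow I n (f + g).
Proof.
move=> [k [c [a [Ia ->]]]] [k' [c' [a' [Ia' ->]]]].
pose pick T (u : 'I_k -> T) (v : 'I_k' -> T) i :=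
  match split i with inl j => u j | inr j => v j end.
exists (k + k')%N, (pick _ c c'), (pick _ a a'); split.
  by move=> i j; rewrite /pick; case: split.
rewrite big_split_ord /=; congr (_ + _); apply: eq_bigr => i _; rewrite /pick.
  by rewrite (unsplitK (inl _ i)).
by rewrite (unsplitK (inr _ i)).
Qed.

Lemma idealpow_sum n (J : Type) (r : seq J) (P : pred J) (f : J -> A) :
  (forall i, P i -> idealpow I n (f i)) ->
  idealpow I n (\sum_(i <- r | P i) f i).
Proof.
by move=> If; elim/big_ind: _ => //; [exact: idealpow0 | exact: idealpowD].
Qed.

Lemma idealpow_ind n (Q : A -> Prop) :
  Q 0 -> (forall f g, Q f -> Q g -> Q (f + g)) ->
  (forall c (a : 'I_n -> A), (forall j, I (a j)) -> Q (c * \prod_(j < n) a j)) ->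
  forall f, idealpow I n f -> Q f.
Proof.
move=> Q0 QD Qprod f [k [c [a [Ia ->]]]].
by elim/big_ind: _ => // i _; apply: Qprod.
Qed.

Lemma idealpowM n n' f g :
  idealpow I n f -> idealpow I n' g -> idealpow I (n + n') (f * g).
Proof.
move=> If Ig; elim/idealpow_ind: If => [|f1 f2|c a Ia].
- by rewrite mul0r; apply: idealpow0.
- by rewrite mulrDl; apply: idealpowD.
elim/idealpow_ind: Ig => [|g1 g2|c' a' Ia'].
- by rewrite mulr0; apply: idealpow0.
- by rewrite mulrDr; apply: idealpowD.
pose b i := match split i with inl j => a j | inr j => a' j end.
suff -> : c * \prod_(j < n) a j * (c' * \prod_(j < n') a' j) =
          c * c' * \prod_(j < n + n') b j.
  by apply: idealpow_prod => j; rewrite /b; case: split.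
rewrite big_split_ord /= mulrACA; congr (_ * (_ * _)).
  by apply: eq_bigr => i _; rewrite /b (unsplitK (inl _ i)).
by apply: eq_bigr => i _; rewrite /b (unsplitK (inr _ i)).
Qed.

Lemma idealpowMl n c f : idealpow I n f -> idealpow I n (c * f).
Proof. by move=> If; apply: (idealpowM (idealpow_exp0 c)). Qed.

Lemma idealpow_gen a : I a -> idealpow I 1 a.
Proof.
move=> Ia; have := @idealpow_prod 1 1 (fun=> a).
by rewrite big_ord1 mul1r; apply.
Qed.

Lemma idealpowX a n : I a -> idealpow I n (a ^+ n).
Proof.
move=> Ia; have := @idealpow_prod n 1 (fun=> a).
by rewrite prodr_const card_ord mul1r; apply.
Qed.

Lemma idealpow_leq m n f : (m <= n)%N -> idealpow I n f -> idealpow I m f.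
Proof.
move=> le_mn; elim/idealpow_ind => [|f1 f2|c a Ia].
- exact: idealpow0.
- exact: idealpowD.
move: a Ia; rewrite -(subnKC le_mn) => a Ia.
by rewrite big_split_ord mulrA mulrC /=; apply/idealpowMl/idealpow_prod.
Qed.

(* [1 - (1 - u v)^n] is a multiple of [u]. *)
Lemma idealpow_cancel_unit n u v g :
  I (1 - u * v) -> idealpow I n (u * g) -> idealpow I n g.
Proof.
move=> Iuv Iug; set w := \sum_(i < n) (1 - u * v) ^+ i.
have -> : g = g * (1 - u * v) ^+ n + v * w * (u * g).
  have -> : (1 - u * v) ^+ n = 1 + (1 - u * v - 1) * w by rewrite -subrX1 subrKC.
  by ring.
by apply: idealpowD; apply: idealpowMl => //; apply: idealpowX.
Qed.

(** Once the powers containing a nonzero [f] are bounded, a largest one exists, found by descending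
    from the bound with excluded middle. Orders can then be handled as plain membership in
    powers. *)
Lemma order_geP n f :
  (f != 0 -> exists N, forall r, idealpow I r f -> (r <= N)%N) ->
  order_ge I f n <-> idealpow I n f.
Proof.
move=> bnd; split=> [[->|[r [[Ir _] le_nr]]]|In].
- exact: idealpow0.
- exact: idealpow_leq Ir.
have [->|nz_f] := eqVneq f 0; [by left | right].
have [N] := bnd nz_f; elim: N => [|N IHN] maxN.
  by exists 0%N; split; [split=> //; apply: idealpow_exp0 | apply: maxN].
have [IN|nIN] := classic (idealpow I N.+1 f).
  by exists N.+1; split; [split | apply: maxN].
apply: IHN => r Ir; rewrite -ltnS ltn_neqAle maxN // andbT.
by apply: contra_notN nIN => /eqP <-.
Qed.

End IdealPowers.

Lemma idealpow_rmorph (A B : comNzRingType) (phi : {rmorphism A -> B})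
    (I : A -> Prop) (J : B -> Prop) n f :
  (forall a, I a -> J (phi a)) -> idealpow I n f -> idealpow J n (phi f).
Proof.
move=> IJ; elim/idealpow_ind => [|f1 f2|c a Ia].
- by rewrite rmorph0; apply: idealpow0.
- by rewrite rmorphD; apply: idealpowD.
by rewrite rmorphM rmorph_prod; apply: idealpow_prod => j; apply/IJ/Ia.
Qed.

(** * Taylor expansion in [z] at an element [h] *)

Section Taylor.
Variables (A : comNzRingType) (I : A -> Prop) (h : A).
Hypothesis I0 : I 0.

Definition eval_ideal (f : {poly A}) : Prop := I f.[h].

Let m0 (f : {poly A}) : Prop := I f`_0.

(** In the coefficient of [X^i] of a product of [n] elements of [m0], at most [i] factors contribute
    a positive power of [X]; the others contribute constant terms, which lie in [I]. *)
Lemma idealpow_coef n f i : idealpow m0 n f -> idealpow I (n - i) f`_i.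
Proof.
elim/idealpow_ind: f / => [|f g If Ig|c a m0a]; last rewrite mulrC.
- by rewrite coef0; apply: idealpow0.
- by rewrite coefD; apply: idealpowD.
have Mc k (f d : {poly A}) : (forall j, idealpow I (k - j) f`_j) ->
    forall j, idealpow I (k - j) (f * d)`_j.
  move=> If j; rewrite coefM; apply: idealpow_sum => -[j' /= lt_j'] _.
  rewrite mulrC; apply/idealpowMl/idealpow_leq/If.
  by rewrite leq_sub2l.
apply: Mc; elim: n a m0a => [|n IHn] a m0a j; first exact: idealpow_exp0.
rewrite big_ord_recl coefM; apply: idealpow_sum => -[j' /= lt_j'] _.
have IHj k : idealpow I (n - k) (\prod_(i0 < n) a (lift ord0 i0))`_k.
  by apply: IHn => i0; apply: m0a.
case: j' lt_j' => [|j'] lt_j'.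
  have Ia0 : I (a ord0)`_0 by apply: m0a.
  by apply: (idealpow_leq _ (idealpowM (idealpow_gen Ia0) (IHj _))); lia.
by apply/idealpowMl/idealpow_leq/IHj; lia.
Qed.

(** Its coefficients are the Taylor coefficients of [f] at [h]. *)
Definition shift (f : {poly A}) : {poly A} := f \Po ('X + h%:P).

Lemma shift_ideal f : eval_ideal f -> m0 (shift f).
Proof.
by rewrite /eval_ideal /m0 -horner_coef0 horner_comp hornerD hornerX hornerC add0r.
Qed.

Lemma idealpow_taylor n i f :
  idealpow eval_ideal n f -> idealpow I (n - i) (shift f)`_i.
Proof.
move=> If; apply: idealpow_coef.
exact: (idealpow_rmorph (phi := comp_poly _) shift_ideal If).
Qed.

(** In the expansion of [f] in powers of [X - h], the [i]-th coefficient supplies [n - i] factors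
    and [(X - h)^i] the other [i]. *)
Lemma taylor_idealpow n f :
  (forall i, idealpow I (n - i) (shift f)`_i) -> idealpow eval_ideal n f.
Proof.
move=> If; rewrite -(comp_polyXaddC_K f h) -/(shift f) comp_polyE.
apply: idealpow_sum => i _; rewrite -mul_polyC.
apply: (@idealpow_leq _ _ _ (n - i + i)); first lia.
apply: idealpowM; last first.
  by apply: idealpowX; rewrite /eval_ideal hornerXsubC subrr.
apply: (idealpow_rmorph (phi := polyC) _ (If i)) => a.
by rewrite /eval_ideal hornerC.
Qed.

Lemma idealpow_eval n f : idealpow eval_ideal n f -> idealpow I n f.[h].
Proof. exact: (idealpow_rmorph (phi := horner_eval h)). Qed.

Lemma idealpow_polyC n a : idealpow I n a -> idealpow eval_ideal n a%:P.
Proof.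
by apply: (idealpow_rmorph (phi := polyC)) => b; rewrite /eval_ideal hornerC.
Qed.

(** Multiplication by [X - h] moves each Taylor coefficient up one place, and [n - (i + 1)] is
    [n.-1 - i]. *)
Lemma idealpow_XsubC n g :
  idealpow eval_ideal n (('X - h%:P) * g) -> idealpow eval_ideal n.-1 g.
Proof.
move=> /idealpow_taylor Ig; apply: taylor_idealpow => i.
move: (Ig i.+1); rewrite /shift rmorphM /= rmorphB /= comp_polyX comp_polyC addrK.
by rewrite coefXM /=; apply: idealpow_leq; lia.
Qed.

(** The top Taylor coefficient is nonzero; its bound plus its degree bounds [n]. *)
Lemma idealpow_poly_bounded f :
  (forall a, a != 0 -> exists N, forall n, idealpow I n a -> (n <= N)%N) ->
  f != 0 -> exists N, forall n, idealpow eval_ideal n f -> (n <= N)%N.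
Proof.
move=> bndI nz_f; have nz_sf : shift f != 0.
  by apply: contraNneq nz_f => sf0; rewrite -(comp_polyXaddC_K f h) -/(shift f) sf0 comp_poly0.
have [|N maxN] := bndI (lead_coef (shift f)); first by rewrite lead_coef_eq0.
exists (N + (size (shift f)).-1)%N => n If.
by have /maxN := idealpow_taylor (size (shift f)).-1 If; lia.
Qed.

End Taylor.

(** * Weighted degrees and irreducibility of the curve *)

Section WeightedDegree.
Variables (F : finFieldType) (q : nat).
Hypothesis q_gt1 : (1 < q)%N.
Implicit Types p r : {poly {poly F}}.
Local Notation h := (hermite_poly F q).

Lemma hermite_monic : h \is monic.
Proof. by rewrite -mk_monic_hermite // monic_mk_monic. Qed.

Lemma size_hermite : size h = q.+1.
Proof.
rewrite /hermite_poly -addrA size_polyDl size_polyXn // ltnS.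
rewrite (leq_trans (size_polyD _ _)) // size_polyX size_polyN.
by rewrite geq_max q_gt1 (leq_trans (size_polyC_leq1 _)) // ltnW.
Qed.

(* [X = T^q] and [Y = U T^(q+1)], where [T] is the outer variable: the degree
   in [T] is the pole order at infinity, and [U] records the exponent of [Y]. *)
Let liftX : {rmorphism {poly F} -> {poly {poly F}}} :=
  map_poly polyC \o comp_poly 'X^q.
Definition weight_lift (p : {poly {poly F}}) : {poly {poly F}} :=
  (map_poly liftX p).['X%:P * 'X^(q.+1)].

Lemma weight_liftM p r : weight_lift (p * r) = weight_lift p * weight_lift r.
Proof. by rewrite /weight_lift rmorphM hornerM. Qed.

Lemma weight_lift_hermite :
  weight_lift h = ('X^q - 1)%:P * 'X^(q * q.+1) + 'X%:P * 'X^(q.+1).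
Proof.
rewrite /weight_lift /hermite_poly rmorphB rmorphD /= map_polyXn map_polyX map_polyC /=.
rewrite hornerD hornerN hornerD hornerXn hornerX hornerC.
rewrite rmorphXn /= comp_polyX -exprM map_polyXn exprMn -exprM mulnC.
by rewrite rmorphB rmorphXn /= polyC1; ring.
Qed.

Lemma lead_coef_weight_lift_hermite : lead_coef (weight_lift h) = 'X^q - 1.
Proof.
have nz : 'X^q - 1 != 0 :> {poly F} by rewrite -size_poly_gt0 size_XnsubC // ltnW.
rewrite weight_lift_hermite lead_coefDl ?lead_coefM ?lead_coefC ?lead_coefXn ?mulr1 //.
by rewrite !size_Cmul ?polyX_eq0 // !size_polyXn; nia.
Qed.

(** The monomial [X^i Y^j] becomes [U^j T^(q i + (q+1) j)], so a coefficient at [T^n U^j] comes from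
    at most one monomial. *)
Lemma coef_weight_lift p n j : (size p <= q)%N ->
  (weight_lift p)`_n`_j =
    if [&& j < q, q.+1 * j <= n & q %| n - q.+1 * j]%N
    then p`_j`_((n - q.+1 * j) %/ q) else 0.
Proof.
move=> le_p; have le_lp : (size (map_poly liftX p) <= q)%N := leq_trans (size_poly _ _) le_p.
rewrite /weight_lift (horner_coef_wide _ le_lp).
rewrite coef_sum coef_sum.
have E (i : 'I_q) : ((map_poly liftX p)`_i * ('X%:P * 'X^(q.+1)) ^+ i)`_n`_j =
    if (i == j :> nat) && ((q.+1 * i <= n) && (q %| n - q.+1 * i))%N
    then p`_i`_((n - q.+1 * i) %/ q) else 0.
  rewrite exprMn -exprM mulrA coefMXn ltnNge.
  case: leqP => _; last by rewrite coef0 andbF.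
  rewrite -rmorphXn /= coefMC coefMXn coef_map /= coef_map /= coefC.
  rewrite coef_comp_poly_Xn; last exact: ltnW.
  by rewrite subn_eq0; case: (ltngtP j i).
under eq_bigr do rewrite E.
case: ltnP => lt_j /=; last first.
  by rewrite big1 // => i _; case: eqP => // e; move: lt_j; rewrite -e leqNgt ltn_ord.
rewrite (bigD1 (Ordinal lt_j)) //= eqxx big1 ?addr0 // => i.
by rewrite -val_eqE /= => /negPf ->.
Qed.

(** The leading coefficient in [T] is a single monomial in [U], hence nonzero at [U = 1]. *)
Lemma lead_coef_weight_lift1 p : (size p <= q)%N -> p != 0 ->
  (lead_coef (weight_lift p)).[1] != 0.
Proof.
move=> le_p nz_p; set a := lead_coef _.
have nz_lp : weight_lift p != 0.
  (* The image of the monomial of [p] leading first in [Y], then in [X], survives. *)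
  set j := (size p).-1; set i := (size p`_j).-1.
  have lt_j : (j < q)%N by rewrite /j; move: nz_p; rewrite -size_poly_gt0; lia.
  apply/eqP => /(congr1 (fun r : {poly {poly F}} => r`_(q * i + q.+1 * j)`_j)).
  rewrite coef_weight_lift // lt_j leq_addl addnK dvdn_mulr //= !coef0 mulKn; last lia.
  by move/eqP; rewrite -lead_coefE lead_coef_eq0 -lead_coefE lead_coef_eq0 (negPf nz_p).
have nz_a : a != 0 by rewrite lead_coef_eq0.
set k := (size a).-1.
(* Since [q i + (q+1) j] is [j] modulo [q] and [j < q], the degree in [T] determines [j]. *)
have a_supp j : a`_j != 0 -> j = ((size (weight_lift p)).-1 %% q)%N.
  rewrite /a lead_coefE coef_weight_lift //; case: ifP; last by rewrite eqxx.
  case/and3P=> lt_j le_n /dvdnP[d dE] _.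
  have -> : (size (weight_lift p)).-1 = ((d + j) * q + j)%N.
    by rewrite -(subnK le_n) dE mulSn mulnDl (mulnC q) addnCA addnC.
  by rewrite modnMDl modn_small.
have lt_k : (k < size a)%N by rewrite prednK // size_poly_gt0.
rewrite horner_coef (bigD1 (Ordinal lt_k)) //=.
rewrite big1 ?addr0 ?expr1n ?mulr1 -?lead_coefE ?lead_coef_eq0 // => -[j lt_j].
rewrite -val_eqE /= => ne_jk; rewrite expr1n mulr1.
apply: contraNeq ne_jk => /a_supp ->; apply/eqP/esym/a_supp.
by rewrite -lead_coefE lead_coef_eq0.
Qed.

(** Leading coefficients in [T] multiply; at [U = 1] that of [h] vanishes, while those of nonzero
    [p] and [r] do not. *)
Lemma hermite_ndvd_mul p r k : (size p <= q)%N -> (size r <= q)%N ->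
  p * r = k * h -> p = 0 \/ r = 0.
Proof.
move=> le_p le_r E; have [->|nz_p] := eqVneq p 0; first by left.
have [->|nz_r] := eqVneq r 0; [by right | exfalso].
have /(congr1 (fun s => (lead_coef s).[1])) := congr1 weight_lift E.
rewrite !weight_liftM !lead_coefM lead_coef_weight_lift_hermite !hornerM.
rewrite !hornerE expr1n subrr mulr0 => /eqP.
by rewrite mulf_eq0 !(negPf (lead_coef_weight_lift1 _ _)).
Qed.

End WeightedDegree.

(** * The coordinate ring over [F[x]] *)

Section HermitianRing.
Variables (F : finFieldType) (q : nat).
Hypothesis q_gt1 : (1 < q)%N.
Local Notation h := (hermite_poly F q).
Local Notation R := (hermite_ring F q).
Local Notation inR := (in_qpoly h).

Lemma size_repr (a : R) : (size (polyn a) <= q)%N.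
Proof. by rewrite -ltnS -(size_hermite F q_gt1) -{2}(mk_monic_hermite F q_gt1) size_mk_monic. Qed.

Lemma in_qpolyK (a : R) : inR (polyn a) = a.
Proof. by apply/val_inj/in_qpoly_small/size_mk_monic. Qed.

Lemma in_qpolyE p : p = Pdiv.Ring.rdivp p h * h + polyn (inR p).
Proof.
by rewrite /= mk_monic_hermite // -Pdiv.RingMonic.rdivp_eq // hermite_monic.
Qed.

Lemma in_qpoly_hermite : inR h = 0.
Proof.
by apply: val_inj; rewrite /= mk_monic_hermite // Pdiv.RingMonic.rmodpp // hermite_monic.
Qed.

(* Irreducibility makes the resultant of a representative of [a] with the
   equation of the curve nonzero. *)
Lemma hermite_ring_norm (a : R) : a != 0 ->
  exists b (N : {poly F}), N != 0 /\ a * b = inR N%:P.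
Proof.
move=> nz_a; set p := polyn a.
have nz_p : p != 0 by [].
have le_p : (size p <= q)%N := size_repr a.
have [/size1_polyC pE|p_gt1] := leqP (size p) 1.
  exists 1, p`_0; rewrite -pE mulr1 in_qpolyK; split=> //.
  by apply: contraNneq nz_p => p0; rewrite pE p0.
have h_gt1 : (1 < size h)%N by rewrite size_hermite // ltnW.
have [[u v] [_ _] E] := resultant_in_ideal p_gt1 h_gt1; rewrite /= in E.
exists (inR u), (resultant p h); split; last first.
  by rewrite E rmorphD !rmorphM /= in_qpoly_hermite mulr0 addr0 in_qpolyK mulrC.
(* A zero resultant would give a nonconstant common factor [d], with [c h = h' d] and [c' p = p' d].
   Then [h' (c' p) = (c p') h], where both factors on the left have degree below [q] in [Y]. *)
rewrite resultant_eq0 -leqNgt leqNgt; apply/negP => d_gt1.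
have /Pdiv.Idomain.dvdpP[[c h'] /= nz_c hE] := dvdp_gcdr p h.
have /Pdiv.Idomain.dvdpP[[c' p'] /= nz_c' pE] := dvdp_gcdl p h.
set d := gcdp p h in d_gt1 hE pE.
have nz_h : h != 0 by rewrite -size_poly_gt0 size_hermite.
have nz_h' : h' != 0.
  apply: contraNneq nz_h => h'0; move: hE; rewrite h'0 mul0r => /eqP.
  by rewrite -mul_polyC mulf_eq0 polyC_eq0 (negPf nz_c).
have le_h' : (size h' <= q)%N.
  have : size (c *: h) = q.+1 by rewrite size_scale // size_hermite.
  rewrite hE size_mul // -?size_poly_gt0; lia.
have := @hermite_ndvd_mul F q q_gt1 h' (c' *: p) (c *: p') le_h'.
case=> [||h'0|/eqP].
- by rewrite size_scale.
- by rewrite -scalerAl scalerAr hE pE mulrCA.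
- by rewrite h'0 eqxx in nz_h'.
by rewrite -mul_polyC mulf_eq0 polyC_eq0 (negPf nz_c') (negPf nz_p).
Qed.

Lemma hermite_scale_inj (p : {poly F}) (a : R) : p != 0 -> p *: a = 0 -> a = 0.
Proof.
move=> nz_p pa0; apply: val_inj.
(* Scaling by [F[x]] acts on the reduced representative without further reduction. *)
have /eqP : p *: polyn a = 0 := congr1 (@polyn _ _) pa0.
by rewrite -mul_polyC mulf_eq0 polyC_eq0 (negPf nz_p) => /eqP.
Qed.

Lemma in_qpolyC (p : {poly F}) : inR p%:P = p%:A.
Proof. by rewrite -alg_polyC linearZ rmorph1. Qed.

Lemma curveE (P : point F q) : py P ^+ q + py P = px P ^+ q.+1.
Proof. exact: eqP (valP P). Qed.

(** * Evaluation and finiteness of orders at a rational point *)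

Hypothesis q_char : q%:R = 0 :> F.

Definition quotY (P : point F q) : {poly F} :=
  ('X^q + 'X - (py P ^+ q)%:P - (py P)%:P) %/ ('X - (py P)%:P).

Lemma quotYK P : quotY P * ('X - (py P)%:P) = 'X^q + 'X - (py P ^+ q)%:P - (py P)%:P.
Proof.
by apply: divpK; rewrite dvdp_XsubCl rootE !hornerE; apply/eqP; ring.
Qed.

(** Differentiate [quotYK] at [py P]: the right side has derivative [q Y^(q-1) + 1 = 1]. *)
Lemma quotY_py P : (quotY P).[py P] = 1.
Proof.
have /(congr1 (fun p : {poly F} => p^`().[py P])) := quotYK P.
rewrite derivM !derivB derivD derivX derivXn !derivC !subr0 !hornerE.
by rewrite subrr mulr0 add0r hornerMn -mulr_natr q_char mulr0 add0r.
Qed.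

Variable P : point F q.

(** The equation of the curve vanishes at [P], so any representative gives the value; hence
    [evalR P] is a ring morphism. *)
Lemma evalR_in_qpoly p : evalR P (inR p) = p.[(py P)%:P].[px P].
Proof.
rewrite [in RHS](in_qpolyE p) hornerD hornerM hornerD hornerM /evalR.
suff -> : h.[(py P)%:P].[px P] = 0 by rewrite mulr0 add0r.
by rewrite /hermite_poly !hornerE /= curveE subrr.
Qed.

Fact evalR_zmod_morphism : zmod_morphism (evalR P).
Proof. by move=> a b; rewrite -[a]in_qpolyK -[b]in_qpolyK -rmorphB !evalR_in_qpoly !hornerE. Qed.

Fact evalR_monoid_morphism : monoid_morphism (evalR P).
Proof.
split=> [|a b]; first by rewrite -(rmorph1 inR) evalR_in_qpoly !hornerE.
by rewrite -[a]in_qpolyK -[b]in_qpolyK -rmorphM !evalR_in_qpoly !hornerE.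
Qed.

HB.instance Definition _ :=
  GRing.isZmodMorphism.Build R F (evalR P) evalR_zmod_morphism.
HB.instance Definition _ :=
  GRing.isMonoidMorphism.Build R F (evalR P) evalR_monoid_morphism.

Lemma evalR_alg (p : {poly F}) : evalR P p%:A = p.[px P].
Proof. by rewrite -in_qpolyC evalR_in_qpoly hornerC. Qed.

Lemma evalRZ (p : {poly F}) a : evalR P (p *: a) = p.[px P] * evalR P a.
Proof. by rewrite -mulr_algl rmorphM /= evalR_alg. Qed.

Hypothesis card_F : #|F| = (q ^ 2)%N.
Let m (a : R) : Prop := evalR P a = 0.

Definition quotYR : R := inR (map_poly polyC (quotY P)).

Lemma evalR_quotYR : evalR P quotYR = 1.
Proof.
by rewrite evalR_in_qpoly horner_map hornerC quotY_py.
Qed.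

(** An element of [m] is a combination of [x - alpha] and [y - beta], and on the curve [quotYR]
    times [y - beta] is [x^(q+1) - alpha^(q+1)], a multiple of [x - alpha]. *)
Lemma max_ideal_quotY (a : R) : m a ->
  exists b : R, quotYR * a = ('X - (px P)%:P) *: b.
Proof.
rewrite /m -[a]in_qpolyK evalR_in_qpoly; set p := polyn a => /rootP.
move=> /factor_theorem[A AE].
have /factor_theorem[B BE] : root (p - p.[(py P)%:P]%:P) (py P)%:P.
  by rewrite rootE !hornerE subrr.
have /factor_theorem[W WE] : root ('X^(q.+1) - (px P ^+ q.+1)%:P : {poly F}) (px P).
  by rewrite rootE !hornerE subrr.
exists (quotYR * inR A%:P + inR B * inR W%:P).
have -> : p = B * ('X - (py P)%:P%:P) + p.[(py P)%:P]%:P by rewrite -BE subrK.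
have YE : quotYR * inR ('X - (py P)%:P%:P) = ('X - (px P)%:P) *: inR W%:P.
  rewrite -rmorphM -linearZ /=.
  have -> : map_poly polyC (quotY P) * ('X - (py P)%:P%:P) =
            h + ('X - (px P)%:P) *: W%:P.
    have -> : 'X - (py P)%:P%:P = map_poly polyC ('X - (py P)%:P) :> {poly {poly F}}.
      by rewrite rmorphB /= map_polyX map_polyC.
    rewrite -rmorphM quotYK -mul_polyC -polyCM mulrC -WE.
    rewrite !rmorphB rmorphD /= !map_polyXn !map_polyX !map_polyC /=.
    rewrite /hermite_poly -(eqP (valP P)) !(rmorphD, rmorphB) /=.
    by rewrite /py; ring.
  by rewrite rmorphD /= in_qpoly_hermite add0r.
rewrite rmorphD rmorphM AE mulrDr mulrCA YE.
rewrite scalerDr addrC; congr (_ + _); last by rewrite scalerAr.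
by rewrite scalerAr -linearZ -mul_polyC -polyCM [A * _]mulrC.
Qed.

Lemma idealpow_quotY n a : idealpow m n a ->
  exists b : R, quotYR ^+ n * a = ('X - (px P)%:P) ^+ n *: b.
Proof.
elim/idealpow_ind => [|f g [b fE] [c gE]|c b mb].
- by exists 0; rewrite mulr0 scaler0.
- by exists (b + c); rewrite mulrDr fE gE scalerDr.
suff [d dE] : exists d : R,
    quotYR ^+ n * \prod_(j < n) b j = ('X - (px P)%:P) ^+ n *: d.
  by exists (c * d); rewrite mulrCA dE scalerAr.
elim: n b mb => [|n IHn] b mb; first by exists 1; rewrite big_ord0 mulr1 scale1r.
rewrite big_ord_recl !exprS mulrACA.
have [d ->] := IHn (b \o lift ord0) (fun j => mb _).
have [e ->] := max_ideal_quotY (mb ord0).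
by exists (e * d); rewrite -scalerAl -scalerAr scalerA.
Qed.

(** The bound is the multiplicity [k] of [alpha] as a root of the norm [N]. Beyond it,
    [(x - alpha)^k] would lie in [m^(k+1)], so [quotYR^(k+1)] would be a multiple of [x - alpha],
    although its value at [P] is 1. *)
Lemma evalR_bounded (a : R) :
  a != 0 -> exists N, forall n, idealpow m n a -> (n <= N)%N.
Proof.
move=> /hermite_ring_norm[b [N [nz_N abE]]].
have [k [N' rN' NE]] := multiplicity_XsubC N (px P).
rewrite nz_N in rN'; exists k => n Ian; rewrite leqNgt; apply/negP => lt_kn.
have : idealpow m n (inR N%:P) by rewrite -abE mulrC; apply: idealpowMl.
rewrite NE in_qpolyC => /(idealpow_leq lt_kn).
have -> : (N' * ('X - (px P)%:P) ^+ k)%:A = N'%:A * (('X - (px P)%:P) ^+ k)%:A :> R.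
  by rewrite mulr_algl scalerA.
(* The cofactor [N'] does not vanish at [alpha], so it can be cancelled. *)
have mN' : m (1 - N'%:A * (N'.[px P]^-1)%:P%:A).
  by rewrite /m rmorphB rmorph1 rmorphM /= !evalR_alg hornerC divff ?subrr.
move=> /(idealpow_cancel_unit mN')/idealpow_quotY[g].
rewrite mulr_algr [('X - _) ^+ k.+1]exprSr -scalerA => /eqP.
rewrite -subr_eq0 -scalerBr => /eqP.
have nz_X : ('X - (px P)%:P) ^+ k != 0 :> {poly F} by rewrite expf_neq0 ?polyXsubC_eq0.
move=> /(hermite_scale_inj nz_X)/(congr1 (evalR P))/eqP.
rewrite rmorphB rmorphXn rmorph0 /= evalR_quotYR evalRZ !hornerE subrr mul0r subr0.
by rewrite expr1n oner_eq0.
Qed.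

(** Lagrange interpolation. At [P'] the quotient in [X] equals the derivative of [X^(q^2) - X],
    namely -1. At another point the quotient in [X] vanishes if the abscissas differ, and [quotY P']
    vanishes otherwise. *)
Lemma evalR_hfun P' : evalR P (hfun P') = (P == P')%:R.
Proof.
rewrite /hfun -/(quotY P') -rmorphN /= evalR_in_qpoly !hornerE horner_map /= hornerC.
set X := _ %/ _.
have XE : X * ('X - (px P')%:P) = 'X^(q ^ 2) - 'X.
  by apply: divpK; rewrite dvdp_XsubCl rootE !hornerE -card_F expf_card subrr.
have [eP|neP] := eqVneq P P'.
  rewrite -eP in XE *; rewrite quotY_py mulr1.
  move: (congr1 (fun p : {poly F} => p^`().[px P]) XE).
  rewrite derivM !derivB derivX derivXn !derivC !subr0 !hornerE subrr mulr0 add0r.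
  rewrite hornerMn -mulr_natr natrX q_char expr0n mulr0 => ->.
  by rewrite sub0r opprK.
have [eqx|nex] := eqVneq (px P) (px P').
  have ney : py P != py P'.
    apply: contra neP => /eqP eqy; apply/eqP/val_inj; move: eqx eqy.
    by rewrite /px /py; case: (val P) (val P') => [? ?] [? ?] /= -> ->.
  have := congr1 (fun p : {poly F} => p.[py P]) (quotYK P').
  rewrite !hornerE => E; suff -> : (quotY P').[py P] = 0 by rewrite mulr0 oppr0.
  apply/eqP; have : (quotY P').[py P] * (py P - py P') == 0.
    by rewrite E -addrA -opprD subr_eq0 !curveE eqx.
  by rewrite mulf_eq0 subr_eq0 (negPf ney) orbF.
suff /eqP -> : X.[px P] == 0 by rewrite mul0r oppr0.
have /eqP := congr1 (fun p : {poly F} => p.[px P]) XE.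
by rewrite !hornerE -card_F expf_card subrr mulf_eq0 subr_eq0 (negPf nex) orbF.
Qed.

(** * Orders and multiplicities as ideal membership *)

Let mz c (f : {poly R}) : Prop := evalRz P c f = 0.

Lemma evalRzE a f : evalRz P (evalR P a) f = evalR P f.[a].
Proof. by rewrite /evalRz horner_map. Qed.

(** The ideal of the point [(P, a(P))] consists of the [f] with [f(a)] in [m], so Taylor expansion
    can be centred at any [a] in [R] with the prescribed value. *)
Lemma idealpow_evalRz a n f :
  idealpow (mz (evalR P a)) n f <-> idealpow (eval_ideal m a) n f.
Proof.
by split; apply: (idealpow_rmorph (phi := idfun)) => g;
   rewrite /mz /eval_ideal /m evalRzE.
Qed.

Let m0 : m 0.
Proof. exact: rmorph0. Qed.

Lemma vR_geP n (a : R) : vR_ge P a n <-> idealpow m n a.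
Proof. by apply: order_geP => /evalR_bounded. Qed.

Lemma mult_geP a n f :
  mult_ge P (evalR P a) f n <-> idealpow (eval_ideal m a) n f.
Proof.
rewrite -idealpow_evalRz; apply: order_geP => nz_f.
have [N maxN] := idealpow_poly_bounded a evalR_bounded nz_f.
by exists N => r /idealpow_evalRz/maxN.
Qed.

Lemma evalR_surj c : exists a, evalR P a = c.
Proof. by exists c%:P%:A; rewrite evalR_alg hornerC. Qed.

Lemma mult_ge0 c f : mult_ge P c f 0.
Proof. by have [a <-] := evalR_surj c; apply/mult_geP/idealpow_exp0. Qed.

Lemma mult_geD c f g n :
  mult_ge P c f n -> mult_ge P c g n -> mult_ge P c (f + g) n.
Proof. have [a <-] := evalR_surj c; rewrite !mult_geP; exact: idealpowD. Qed.

Lemma mult_geN c f n : mult_ge P c f n -> mult_ge P c (- f) n.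
Proof.
by have [a <-] := evalR_surj c; rewrite !mult_geP -mulN1r; apply: idealpowMl.
Qed.

Lemma mult_ge_polyC c (a : R) n : vR_ge P a n -> mult_ge P c a%:P n.
Proof.
by have [b <-] := evalR_surj c; rewrite vR_geP mult_geP; apply: idealpow_polyC.
Qed.

Lemma mult_ge_horner a f n : mult_ge P (evalR P a) f n -> vR_ge P f.[a] n.
Proof. by rewrite vR_geP mult_geP; apply: idealpow_eval. Qed.

Lemma mult_ge_XsubC a c g n :
  mult_ge P c (('X - a%:P) * g) n <->
  mult_ge P c g (if c == evalR P a then n.-1 else n).
Proof.
have [->|] := eqVneq c (evalR P a).
  rewrite !mult_geP; split; first exact: idealpow_XsubC.
  move=> Ig; have mX : eval_ideal m a ('X - a%:P) by rewrite /eval_ideal hornerXsubC subrr.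
  by apply: (idealpow_leq _ (idealpowM (idealpow_gen mX) Ig)); lia.
have [b <-] := evalR_surj c => neq; rewrite !mult_geP.
split; last exact: idealpowMl.
(* Here [z - a] takes the nonzero value [b(P) - a(P)], whose inverse constant inverts it modulo the
   ideal. *)
apply: (@idealpow_cancel_unit _ _ _ _ ((evalR P b - evalR P a)^-1%:P%:A)%:P).
rewrite /eval_ideal /m !hornerE rmorphB rmorph1 rmorphM rmorphB /= evalR_alg hornerC.
by rewrite divff ?subrr // subr_eq0.
Qed.

Lemma evalR_hstep (M : multmatrix F q) (gam : point F q -> F) :
  evalR P (hstep M gam) = if P \in Lset M then gam P else 0.
Proof.
rewrite /hstep rmorph_sum /=.
under eq_bigr do rewrite evalRZ hornerC evalR_hfun mulr_natr mulrb.
rewrite -big_mkcondr /= big_mkcond /= (bigD1 P) //= big1 => [|P' /negPf neP].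
  by rewrite eqxx andbT addr0.
by rewrite eq_sym neP andbF.
Qed.

End HermitianRing.

(** * Induction over the rounds *)

Section Rounds.
Variables (F : finFieldType) (q : nat).
Hypotheses (q_gt1 : (1 < q)%N) (card_F : #|F| = (q ^ 2)%N).
Hypothesis q_char : q%:R = 0 :> F.
Local Notation R := (hermite_ring F q).
Implicit Types (M : multmatrix F q) (P : point F q).

Lemma IM_XsubC_hstep M (gam : point F q -> F) g :
  IM M (('X - (hstep M gam)%:P) * g) <-> IM (lower M gam) g.
Proof.
have E P c : mult_ge P c (('X - (hstep M gam)%:P) * g) (M P c) <->
             mult_ge P c g (lower M gam P c).
  rewrite mult_ge_XsubC // evalR_hstep // /lower; have [//|] := boolP (P \in Lset M).
  (* Off [L] every entry of the row is 0, and both conditions hold trivially. *)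
  rewrite /= inE -ltnNge ltnS leqn0 => /eqP M0.
  have -> : M P c = 0%N.
    by apply/eqP; rewrite -leqn0 -M0; exact: (@leq_bigmax _ (M P)).
  by rewrite /= if_same; split=> _; apply: mult_ge0.
by split=> IMf P c; apply/E.
Qed.

(** [mat] unfolds at its last round, whereas the induction removes the first. *)
Lemma matS M gam s :
  mat M gam s.+1 = mat (lower M (gam 0%N)) (fun r => gam r.+1) s.
Proof. by elim: s => //= s <-. Qed.

Lemma gpolyS M gam (eta : nat -> 'I_q -> R) s t :
  gpoly M gam eta s.+1 t = ('X - (hstep M (gam 0%N))%:P) *
    gpoly (lower M (gam 0%N)) (fun r => gam r.+1) (fun r => eta r.+1) s t.
Proof.
rewrite /gpoly big_ord_recl [LHS]mulrCA.
apply: (congr1 ( *%R _)); apply: (congr1 ( *%R _)).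
by apply: eq_bigr => r _; rewrite -matS.
Qed.

Lemma gpoly0 M gam (eta : nat -> 'I_q -> R) t : gpoly M gam eta 0 t = (eta 0%N t)%:P.
Proof. by rewrite /gpoly big_ord0 mulr1. Qed.

(** Induction on the number [n] of rounds for all [M] at once: the later rounds are a run on the
    lowered matrix, applied to the quotient by [z - h]. *)
Lemma IM_rounds n M gam (eta : nat -> 'I_q -> R) :
  (forall s, (s < n)%N -> valid_choice (mat M gam s) (gam s) (eta s)) ->
  forall f, (IM M f /\ (size f <= n)%N) <->
  exists c : nat -> 'I_q -> {poly F},
    f = \sum_(s < n) \sum_t (c s t)%:A *: gpoly M gam eta s t.
Proof.
elim: n M gam eta => [|n IHn] M gam eta valid f.
  split=> [[_]|[c ->]].
    by rewrite leqn0 size_poly_eq0 => /eqP ->; exists (fun _ _ => 0); rewrite big_ord0.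
  by rewrite big_ord0 size_poly0; split=> // P x; left.
have [gamM spanM _] := valid 0%N isT.
set h := hstep M (gam 0%N).
have {}IHn := IHn (lower M (gam 0%N)) (fun r => gam r.+1) (fun r => eta r.+1).
have {}IHn := IHn (fun s lt_s =>
  eq_ind _ (fun M' => valid_choice M' _ _) (valid s.+1 lt_s) _ (matS M gam s)).
have const a : spanR (eta 0%N) a -> IM M a%:P.
  move=> /spanM va P c; apply: mult_ge_polyC => //.
  have /(vR_geP q_gt1 q_char) Ia := va P; apply/(vR_geP q_gt1 q_char).
  apply: (idealpow_leq _ Ia).
  exact: (@leq_bigmax _ (M P)).
split=> [[IMf le_f]|[c ->]].
  (* Division by [z - h]: the remainder [f(h)] belongs to the first round, the quotient [g] to the
     later ones. *)
  have /factor_theorem[g gE] : root (f - f.[h]%:P) h by rewrite rootE !hornerE subrr.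
  have span_fh : spanR (eta 0%N) f.[h].
    apply/spanM => P; have [PL|PL] := boolP (P \in Lset M).
      apply: mult_ge_horner => //; rewrite evalR_hstep // PL -gamM //; exact: IMf.
    move: PL; rewrite inE -ltnNge ltnS leqn0 => /eqP ->.
    exact/(vR_geP q_gt1 q_char)/idealpow_exp0.
  have /IHn[c cE] : IM (lower M (gam 0%N)) g /\ (size g <= n)%N.
    split.
      apply/IM_XsubC_hstep => P c; rewrite mulrC -gE; apply: mult_geD => //.
      by apply: mult_geN => //; apply: const.
    have [->|nz_g] := eqVneq g 0; first by rewrite size_poly0.
    have : (size (g * ('X - h%:P))%R <= n.+1)%N.
      rewrite -gE (leq_trans (size_polyD _ _)) // size_polyN geq_max le_f.
      exact: leq_trans (size_polyC_leq1 _) _.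
    by rewrite size_Mmonic ?monicXsubC // size_XsubC addn2.
  have [c0 c0E] := span_fh.
  exists (fun s => if s is s'.+1 then c s' else c0).
  rewrite big_ord_recl /= -[LHS](subrK f.[h]%:P) gE addrC; congr (_ + _).
    rewrite c0E rmorph_sum; apply: eq_bigr => t _ /=.
    by rewrite gpoly0 -mul_polyC -rmorphM /= mulr_algl.
  rewrite mulrC cE mulr_sumr; apply: eq_bigr => s _; rewrite mulr_sumr.
  by apply: eq_bigr => t _; rewrite gpolyS -scalerAr.
(* Conversely, the first round sums to a constant [a] in [z], and the later rounds to
   [(z - h) g]. *)
rewrite big_ord_recl /=.
pose g := \sum_(s < n) \sum_t (c s.+1 t)%:A *:
  gpoly (lower M (gam 0%N)) (fun r => gam r.+1) (fun r => eta r.+1) s t.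
have [IMg le_g] : IM (lower M (gam 0%N)) g /\ (size g <= n)%N.
  by apply/IHn; exists (fun s => c s.+1).
pose a := \sum_t c 0%N t *: eta 0%N t.
have -> : \sum_(i < n) \sum_t (c (bump 0 i) t)%:A *: gpoly M gam eta (bump 0 i) t =
          ('X - h%:P) * g.
  rewrite mulr_sumr; apply: eq_bigr => s _; rewrite mulr_sumr.
  by apply: eq_bigr => t _; rewrite gpolyS -scalerAr.
have -> : \sum_t (c 0%N t)%:A *: gpoly M gam eta 0 t = a%:P.
  rewrite rmorph_sum; apply: eq_bigr => t _ /=.
  by rewrite gpoly0 -mul_polyC -rmorphM /= mulr_algl.
split.
  move=> P x; apply: mult_geD => //; last exact: (IM_XsubC_hstep _ _ _).2.
  by apply: const; exists (c 0%N).
rewrite (leq_trans (size_polyD _ _)) // geq_max (leq_trans (size_polyC_leq1 _)) //=.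
rewrite mulrC; have [->|nz_g] := eqVneq g 0; first by rewrite mul0r size_poly0.
by rewrite size_Mmonic ?monicXsubC // size_XsubC addn2.
Qed.

End Rounds.

(** * From [l + 1] rounds to the module of degree at most [l] *)

Theorem mainTheorem3 (F : finFieldType) (q : nat)
  (q_primepower : exists p k : nat, [/\ prime p, (0 < k)%N & q = (p ^ k)%N])
  (card_F : #|F| = (q ^ 2)%N)
  (M : multmatrix F q) (l : nat)
  (gam : nat -> point F q -> F) (eta : nat -> 'I_q -> hermite_ring F q)
  (choices : forall s, (s <= l)%N ->
     valid_choice (mat M gam s) (gam s) (eta s)) :
  forall f : {poly hermite_ring F q},
    IMl M l f <->
    spanRz (fun st : 'I_l.+1 * 'I_q => gpoly M gam eta st.1 st.2) f.
Proof.
have [p [k [p_prime k_gt0 qE]]] := q_primepower.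
have q_gt1 : (1 < q)%N.
  by have := finNzRing_gt1 F; rewrite card_F; case: (q) => [|[]].
have q_char : (q%:R : F) = 0.
  (* The order of [F] is a power of [p], so [F] has characteristic [p], which divides [q]. *)
  have /card_finPcharP/(_ p_prime)/andP[_ /eqP p0] : #|F| = (p ^ (k * 2))%N.
    by rewrite card_F qE expnM.
  by rewrite qE natrX p0 expr0n eqn0Ngt k_gt0.
move=> f; have valid s : (s < l.+1)%N -> valid_choice (mat M gam s) (gam s) (eta s).
  by rewrite ltnS; apply: choices.
rewrite /IMl (IM_rounds q_gt1 card_F q_char valid).
split=> [[c ->]|[c ->]].
  exists (fun st : 'I_l.+1 * 'I_q => c st.1 st.2); rewrite (pair_bigA _ (fun s t => _)) /=.
  by apply: eq_bigr.
exists (fun s t => c (inord s, t)); rewrite pair_bigA /=.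
by apply: eq_bigr => -[s t] _ /=; rewrite inord_val.
Qed.
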